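(* Let $\varphi:\operatorname{End}(\mathbb{C}^n)\to\operatorname{End}(\mathbb{C}^n)$ be given by $A\mapsto J*A$, where $J$ is a matrix all of whose non-diagonal entries are non-zero, and let $Z\in\operatorname{End}(\mathbb{C}^n)$. Then $$\mathfrak{S}^\varphi_\cap(Z)=\mathfrak{S}_\cap(Z).$$ In particular, if $Z$ is singular, then $\mathfrak{S}^\varphi_\cap(Z)=\{\lambda I\mid\lambda\in\mathbb{C}\}$.
   Context: $\operatorname{End}(\mathbb{C}^n)$ is identified with $n\times n$ complex matrices with the operator norm, and $\operatorname{Aut}(\mathbb{C}^n)$ is the group of invertible ones. $J*A$ is the Hadamard (entrywise) product. ''Singular'' means not invertible. For a linear map $\varphi:\operatorname{End}(\mathbb{C}^n)\to\operatorname{End}(\mathbb{C}^n)$ and $A,Z\in\operatorname{End}(\mathbb{C}^n)$ put $$\mathfrak{N}^\varphi_\cap(A,Z) := \limsup_{r\to 0}\ \sup_{U\in\operatorname{Aut}(\mathbb{C}^n),\ \|U-Z\|<r}\|\varphi(UAU^{-1})\|,\qquad \mathfrak{S}^\varphi_\cap(Z) := \{A\in\operatorname{End}(\mathbb{C}^n)\mid \mathfrak{N}^\varphi_\cap(A,Z)<\infty\},$$ and $\mathfrak{S}_\cap(Z):=\mathfrak{S}^{\mathrm{id}}_\cap(Z)$. *)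

(* Defs.v *)
From HB Require Import structures.
From mathcomp Require Import all_boot all_order all_algebra.
From mathcomp Require Import complex.
From mathcomp Require Import all_classical all_reals all_analysis.
Set Implicit Arguments.
Unset Strict Implicit.
Unset Printing Implicit Defensive.
Import Order.TTheory GRing.Theory Num.Theory.
Import numFieldNormedType.Exports.
Local Open Scope classical_set_scope.
Local Open Scope complex_scope.
Local Open Scope ring_scope.

Definition euclidean_norm (R : realType) (n : nat) (v : 'cV[R[i]]_n) : R :=
  Num.sqrt (\sum_(i < n) Normc.normc (v i 0) ^+ 2).

(* The library's norm on matrices is the entrywise maximum, hence this
   definition; the set is bounded above (by the Frobenius norm of A). *)
Definition op_norm (R : realType) (n : nat) (A : 'M[R[i]]_n) : R :=
  sup [set euclidean_norm (A *m v) |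
       v in [set v : 'cV[R[i]]_n | euclidean_norm v <= 1]].

Definition hadamard (R : realType) (n : nat) (J A : 'M[R[i]]_n) : 'M[R[i]]_n :=
  map2_mx *%R J A.

Fact hadamard_is_linear (R : realType) (n : nat) (J : 'M[R[i]]_n) :
  linear (hadamard J).
Proof.
by move=> a A B; apply/matrixP => i j; rewrite !mxE mulrDr mulrCA.
Qed.

HB.instance Definition _ (R : realType) (n : nat) (J : 'M[R[i]]_n) :=
  GRing.isLinear.Build R[i] 'M[R[i]]_n 'M[R[i]]_n *:%R (hadamard J)
    (hadamard_is_linear J).

(* The radius r tends to 0 from the right: for r <= 0 the supremum is taken
   over the empty set.  Both suprema are taken in \bar R, so that N_cap may be
   +oo. *)
Definition N_cap (R : realType) (n : nat)
    (phi : {linear 'M[R[i]]_n -> 'M[R[i]]_n}) (A Z : 'M[R[i]]_n) : \bar R :=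
  limf_esup
    (fun r : R =>
       ereal_sup [set (op_norm (phi (U *m A *m invmx U)))%:E |
                  U in [set U : 'M[R[i]]_n |
                        U \in unitmx /\ op_norm (U - Z) < r]])
    0^'+.

Definition S_cap (R : realType) (n : nat)
    (phi : {linear 'M[R[i]]_n -> 'M[R[i]]_n}) (Z : 'M[R[i]]_n) :
    set 'M[R[i]]_n :=
  [set A | (N_cap phi A Z < +oo)%E].

(* Main.v *)
Require Import Defs.
From HB Require Import structures.
From mathcomp Require Import all_boot all_order all_algebra.
From mathcomp Require Import complex.
From mathcomp Require Import all_classical all_reals all_analysis.
From mathcomp Require Import ring.
Set Implicit Arguments.
Unset Strict Implicit.
Unset Printing Implicit Defensive.
Import Order.TTheory GRing.Theory Num.Theory.
Import numFieldNormedType.Exports.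
Local Open Scope classical_set_scope.
Local Open Scope complex_scope.
Local Open Scope ring_scope.

(* Write B = U A U^-1.  Replacing U by (1 + t E_ij) U, which is still close to Z
   for a small fixed t, turns a bound on the off-diagonal entries of all such B
   into a bound on the differences B_jj - B_ii; since tr B = tr A, the diagonal
   entries are bounded too.  If moreover Z v = 0 with v != 0, boundedness of B
   forces A to preserve the kernel of every U near Z.  Any x close to v is killed
   by such a U, and also by U + t P for a small multiple of a projection P with
   kernel spanned by x, so P A x = 0 and x is an eigenvector of A.  A matrix for
   which all vectors near v are eigenvectors is scalar. *)

(** * Boundedness of conjugates, entry by entry *)

(** Entrywise form of finiteness of the limsup. It involves no suprema and makes sense over any
    [numFieldType]; [S_capP] identifies it with membership in [S_cap] over [R[i]]. *)
Definition conj_bounded (K : numFieldType) (n : nat) (phi : 'M[K]_n -> 'M[K]_n)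
    (A Z : 'M[K]_n) : Prop :=
  exists r M : K, [/\ 0 < r, 0 <= M & forall U, U \in unitmx ->
    (forall i j, `|U i j - Z i j| < r) ->
    forall i j, `|phi (U *m A *m invmx U) i j| <= M].

(** The order on [K] is partial; ab/(a+b) lies below both numbers without comparing them. *)
Lemma exists_lower_bound2 (K : numFieldType) (a b : K) : 0 < a -> 0 < b ->
  exists c, [/\ 0 < c, c <= a & c <= b].
Proof.
move=> a0 b0; have ab0 : 0 < a + b by rewrite addr_gt0.
exists (a * b / (a + b)); split; first by rewrite divr_gt0 ?mulr_gt0.
  by rewrite ler_pdivrMr// ler_pM2l// lerDr ltW.
by rewrite ler_pdivrMr// mulrC ler_pM2l// lerDl ltW.
Qed.

Definition mx_norm1 (K : numFieldType) (m n : nat) (A : 'M[K]_(m, n)) : K :=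
  \sum_i \sum_j `|A i j|.

Lemma mx_norm1_ge0 (K : numFieldType) (m n : nat) (A : 'M[K]_(m, n)) :
  0 <= mx_norm1 A.
Proof. by do 2!apply: sumr_ge0 => ? _. Qed.

Lemma ler_sum_term (K : numDomainType) (I : finType) (F : I -> K) (i : I) :
  (forall j, 0 <= F j) -> F i <= \sum_j F j.
Proof. by move=> F0; rewrite (bigD1 i)//= lerDl sumr_ge0. Qed.

Lemma ler_norm_mx_norm1 (K : numFieldType) (m n : nat) (A : 'M[K]_(m, n)) i j :
  `|A i j| <= mx_norm1 A.
Proof.
apply: le_trans (ler_sum_term i (F := fun i => \sum_j `|A i j|) _) => [|k].
  exact: (ler_sum_term j (F := fun j => `|A i j|)).
by apply: sumr_ge0.
Qed.

(** * Hadamard multiplication and boundedness *)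

Lemma conj_bounded_hadamard (K : numFieldType) (n : nat) (J A Z : 'M[K]_n) :
  conj_bounded id A Z -> conj_bounded (map2_mx *%R J) A Z.
Proof.
case=> r [M [r0 M0 AM]]; exists r, (mx_norm1 J * M); split => //.
  by rewrite mulr_ge0 ?mx_norm1_ge0.
move=> U Uu UZ i j; rewrite mxE normrM ler_pM ?ler_norm_mx_norm1//.
exact: AM.
Qed.

(** With T = 1 + t E_ij and U' = T U one has B' T = T B. Its (i,i) entry gives B'_ii = B_ii + t
    B_ji, which eliminates B'_ii from the (i,j) entry. *)
Lemma conj_transvection (K : fieldType) (n : nat) (A U : 'M[K]_n) (i j : 'I_n)
    (t : K) : i != j -> U \in unitmx ->
  let U' := U + t *: (delta_mx i j *m U) in
  let B := U *m A *m invmx U in let B' := U' *m A *m invmx U' in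
  U' \in unitmx /\
  B' i j + t * (B i i + t * B j i) = B i j + t * B j j.
Proof.
move=> ij Uu U' B B'; pose T : 'M[K]_n := 1%:M + t *: delta_mx i j.
have U'E : U' = T *m U by rewrite mulmxDl mul1mx -scalemxAl.
have Tu : T \in unitmx.
  suff /mulmx1_unit[] : T *m (1%:M - t *: delta_mx i j) = 1%:M by [].
  rewrite mulmxBr mulmx1 mulmxDl mul1mx -scalemxAl -scalemxAr.
  by rewrite mul_delta_mx_cond eq_sym (negbTE ij) mulr0n !scaler0 addr0 addrK.
have U'u : U' \in unitmx by rewrite U'E unitmx_mul Tu.
split=> //.
have BT : B' *m T = T *m B.
  apply: (can_inj (mulmxK Uu)); rewrite -[LHS]mulmxA -U'E mulmxKV//.
  by rewrite -[RHS]mulmxA mulmxKV// U'E mulmxA.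
clearbody B B'.
have lE (k l : 'I_n) : (B' *m T) k l = B' k l + t * (B' k i *+ (l == j)).
  rewrite mulmxDr mulmx1 -scalemxAr !mxE (bigD1 i)//= big1 ?addr0.
    by rewrite !mxE eqxx /= mulr_natr.
  by move=> m mi; rewrite !mxE (negbTE mi) mulr0.
have rE (k l : 'I_n) : (T *m B) k l = B k l + t * (B j l *+ (k == i)).
  rewrite mulmxDl mul1mx -scalemxAl !mxE (bigD1 j)//= big1 ?addr0.
    by rewrite !mxE eqxx andbT mulr_natl.
  by move=> m mi; rewrite !mxE (negbTE mi) andbF mul0r.
have := lE i i; rewrite BT rE eqxx (negbTE ij) mulr0n mulr0 addr0 => ->.
by have := lE i j; rewrite BT rE !eqxx => ->.
Qed.

Lemma conj_bounded_of_hadamard (K : numFieldType) (n : nat) (J A Z : 'M[K]_n) :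
  (forall i j, i != j -> J i j != 0) ->
  conj_bounded (map2_mx *%R J) A Z -> conj_bounded id A Z.
Proof.
move=> J0 [r [M [r0 M0 AM]]].
(* A zero on the diagonal of [J] has inverse 0 here, which is harmless: only off-diagonal inverses
   are used. *)
pose C := mx_norm1 (map_mx (fun x => x^-1) J) * M.
have C0 : 0 <= C by rewrite mulr_ge0 ?mx_norm1_ge0.
have offdiag U i j : U \in unitmx -> (forall i j, `|U i j - Z i j| < r) ->
    i != j -> `|(U *m A *m invmx U) i j| <= C.
  move=> Uu UZ ij; have := AM U Uu UZ i j; rewrite mxE normrM => AMij.
  have Jij := J0 _ _ ij.
  rewrite -[leLHS](mulKf (x := `|J i j|)) ?normr_eq0//.
  rewrite ler_pM ?invr_ge0 ?mulr_ge0// -normfV.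
  by have := ler_norm_mx_norm1 (map_mx (fun x => x^-1) J) i j; rewrite mxE.
(* [S] bounds the entries of every U within r/2 of Z. As t S = r/2, adding t E_ij U moves U by at
   most r/2, so U' stays within r of Z. *)
pose S := mx_norm1 Z + r.
have S0 : 0 < S by rewrite ltr_wpDl ?mx_norm1_ge0.
have r20 : 0 < r / 2 by rewrite divr_gt0.
pose t := r / 2 / S.
have t0 : 0 < t by rewrite divr_gt0.
have lt_r2 x : x < r / 2 -> x < r.
  by move=> /lt_trans; apply; rewrite ltr_pdivrMr// ltr_pMr// ltr1n.
(* Solving the transvection identity for B_ii - B_jj leaves (B_ij - B'_ij)/t - t B_ji, where each
   entry is off-diagonal. *)
pose D := t^-1 * (C + C) + t * C.
have D0 : 0 <= D by rewrite addr_ge0// mulr_ge0 ?invr_ge0 ?addr_ge0 ?(ltW t0).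
have diag U i j : U \in unitmx -> (forall i j, `|U i j - Z i j| < r / 2) ->
    `|(U *m A *m invmx U) i i - (U *m A *m invmx U) j j| <= D.
  move=> Uu UZ; have [<-|ij] := eqVneq i j; first by rewrite subrr normr0.
  have UZr k l : `|U k l - Z k l| < r by exact: lt_r2.
  have [] := conj_transvection A t ij Uu.
  set U' := U + _; set B := U *m A *m invmx U.
  set B' := U' *m A *m invmx U' => U'u BE.
  have U'Z k l : `|U' k l - Z k l| < r.
    have -> : U' k l - Z k l = (U k l - Z k l) + t * (delta_mx i j *m U) k l.
      by rewrite !mxE addrAC.
    rewrite [ltRHS](splitr r) (le_lt_trans (ler_normD _ _))// ltr_leD//.
    have -> : r / 2 = t * S by rewrite divfK ?gt_eqF.
    rewrite normrM (gtr0_norm t0) ler_pM2l//.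
    rewrite mxE (bigD1 j)//= big1 ?addr0 => [|m mj]; last first.
      by rewrite !mxE (negbTE mj) andbF mul0r.
    rewrite !mxE eqxx andbT normrM; apply: (@le_trans _ _ `|U j l|).
      by rewrite ler_piMl//; case: (k == i); rewrite ?normr1 ?normr0.
    rewrite -[U j l](subrK (Z j l)) (le_trans (ler_normD _ _))// addrC.
    by rewrite lerD ?ler_norm_mx_norm1// ltW.
  have -> : B i i - B j j = t^-1 * (B i j - B' i j) - t * B j i.
    have -> : B i j = B' i j + t * (B i i + t * B j i) - t * B j j.
      by rewrite BE addrK.
    by field; rewrite gt_eqF.
  rewrite (le_trans (ler_normB _ _))// lerD// normrM gtr0_norm ?invr_gt0//.
    rewrite ler_pM2l ?invr_gt0// (le_trans (ler_normB _ _))//.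
    by rewrite lerD// offdiag.
  by rewrite ler_pM2l// offdiag// eq_sym.
exists (r / 2), (C + (`|\tr A| + D *+ n)); split => //.
  by rewrite !addr_ge0// mulrn_wge0.
move=> U Uu UZ i j /=; have [<-|ij] := eqVneq i j; last first.
  rewrite (le_trans (offdiag _ _ _ _ _ _))//; first by move=> *; apply: lt_r2.
  by rewrite lerDl addr_ge0// mulrn_wge0.
rewrite -[leLHS]add0r lerD//; set B := U *m A *m invmx U.
have n0 : (0 < n)%N by case: (n) i => [[]|].
have trB : \tr B = \tr A by rewrite mxtrace_mulC mulmxA mulVmx// mul1mx.
(* Each diagonal entry is the mean of the diagonal, known from the trace, plus the mean of bounded
   differences. *)
have nB : B i i *+ n = \tr A + \sum_j (B i i - B j j).
  by rewrite sumrB sumr_const card_ord -trB addrCA subrr addr0.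
apply: (@le_trans _ _ `|B i i *+ n|).
  by rewrite normrMn -[leLHS]mulr1n ler_wpMn2l.
rewrite nB (le_trans (ler_normD _ _))// lerD//.
rewrite (le_trans (ler_norm_sum _ _ _))//.
rewrite -[n in leRHS]card_ord -sumr_const ler_sum// => k _.
exact: diag.
Qed.

(** * Singular Z: only scalar matrices remain *)

(** The shift fails only if -s is a root of the characteristic polynomial p; the [size p] distinct
    candidates e/(k+1) outnumber its roots. *)
Lemma exists_unit_shift (K : numFieldType) (n : nat) (U : 'M[K]_n) (e : K) :
  0 < e -> exists s, [/\ 0 < s, s <= e & U + s%:M \in unitmx].
Proof.
move=> e0; pose p := char_poly U.
pose f (k : nat) : K := e / k.+1%:R.
have : ~~ all (root p) (map (fun k => - f k) (iota 0 (size p))).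
  apply/negP => /(max_poly_roots (monic_neq0 (char_poly_monic _))).
  rewrite map_inj_uniq ?iota_uniq; last first.
    move=> k l /oppr_inj/(mulfI (lt0r_neq0 e0)) /invr_inj /eqP.
    by rewrite eqr_nat eqSS => /eqP.
  by rewrite size_map size_iota ltnn => /(_ isT).
rewrite -has_predC => /hasP[_ /mapP[k _ ->]] /=.
rewrite -eigenvalue_root_char negbK kermx_eq0 row_free_unit.
rewrite raddfN opprK => fU.
exists (f k); split.
- by rewrite divr_gt0.
- by rewrite ler_pdivrMr// ler_peMr ?ler1n// ltW.
- by [].
Qed.

(* Applying [U A = B U] to the invertible U + s in place of U, where B is
   bounded independently of s, and letting s tend to 0. *)
Lemma conj_bounded_ker_stable (K : numFieldType) (n : nat) (A Z : 'M[K]_n) :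
  conj_bounded id A Z ->
  exists r : K, 0 < r /\
    forall U : 'M[K]_n, (forall i j, `|U i j - Z i j| < r) ->
    forall x : 'cV[K]_n, U *m x = 0 -> U *m A *m x = 0.
Proof.
case=> r [M [r0 M0 AM]]; have r20 : 0 < r / 2 by rewrite divr_gt0.
exists (r / 2); split => // U UZ x Ux.
apply/matrixP => i j; rewrite [in RHS]mxE; apply/eqP; apply/negPn/negP => c0.
set c := (_ *m x) i j in c0.
(* [k] strictly exceeds |(B x)_ij| + |(A x)_ij|, whatever the shift s. Hence |c| < s k, against s <=
   |c| / k. *)
pose k := M * mx_norm1 x + (mx_norm1 (A *m x) + 1).
have k0 : 0 < k.
  by rewrite !ltr_wpDl ?mulr_ge0 ?mx_norm1_ge0.
have [||e [e0 er ec]] := @exists_lower_bound2 _ (r / 2) (`|c| / k).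
- by [].
- by rewrite divr_gt0 ?normr_gt0.
have [s [s0 se Vu]] := exists_unit_shift U e0.
pose V : 'M[K]_n := U + s%:M; pose B : 'M[K]_n := V *m A *m invmx V.
have BM := AM V Vu.
have {}BM a b : `|B a b| <= M.
  apply: BM => {}a {}b; rewrite 2!mxE addrAC [ltRHS](splitr r).
  rewrite (le_lt_trans (ler_normD _ _))// ltr_leD//.
  apply: le_trans (le_trans se er).
  by case: (a == b); rewrite ?mulr1n ?mulr0n ?normr0 ?(gtr0_norm s0)// ltW.
(* V A x = B V x = s B x because U x = 0, while V A x = U A x + s A x. *)
have cE : c = s * ((B *m x) i j - (A *m x) i j).
  have : V *m A *m x = s *: (B *m x).
    rewrite -[V *m A](mulmxKV Vu) -/B -mulmxA mulmxDl Ux add0r.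
    by rewrite mul_scalar_mx scalemxAr.
  move=> /(congr1 (fun X : 'cV_n => X i j)).
  rewrite /V mulmxDl mulmxDl mul_scalar_mx -scalemxAl => VE.
  by rewrite mulrBr; move: VE; rewrite mxE -/c !mxE => <-; rewrite addrK.
have : `|c| < s * k.
  rewrite cE normrM (gtr0_norm s0) ltr_pM2l//.
  rewrite (le_lt_trans (ler_normB _ _))// ler_ltD//; last first.
    by rewrite (le_lt_trans (ler_norm_mx_norm1 _ _ _))// ltrDl.
  rewrite mxE (le_trans (ler_norm_sum _ _ _))// mulr_sumr ler_sum// => l _.
  by rewrite normrM ler_pM// (ler_sum_term j (F := fun j => `|x l j|)).
rewrite -ltr_pdivrMr// => /lt_le_trans/(_ se)/lt_le_trans/(_ ec).
by rewrite ltxx.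
Qed.

Lemma mul_cV_mx11 (K : comPzRingType) (n : nat) (x : 'cV[K]_n) (y : 'M[K]_1) :
  x *m y = y 0 0 *: x.
Proof. by rewrite [y]mx11_scalar mul_mx_scalar mxE eqxx mulr1n. Qed.

Lemma conj_bounded_singular_scalar (K : numFieldType) (n : nat)
    (A Z : 'M[K]_n) :
  Z \notin unitmx -> conj_bounded id A Z -> exists lambda : K, A = lambda%:M.
Proof.
rewrite unitmxE unitfE negbK -det_tr => /det0P[v' v'0 v'Z].
move=> /conj_bounded_ker_stable[r [r0 Aker]].
pose v := v'^T; have Zv : Z *m v = 0.
  by rewrite -[LHS]trmxK trmx_mul trmxK v'Z trmx0.
(* If g w = 0, then g x = 1 for every x = v + s w, so x g projects onto the line of x and 1 - x g
   has kernel spanned by x. *)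
have [g gv] : exists g : 'rV_n, g *m v = 1%:M.
  have /existsP[i vi] : [exists i, v i 0 != 0].
    apply: contraNT v'0 => /existsPn v0; apply/eqP/rowP => i.
    by have /negPn/eqP := v0 i; rewrite !mxE.
  exists ((v i 0)^-1 *: delta_mx 0 i); rewrite -scalemxAl -rowE.
  by apply/matrixP => a b; rewrite mxE in vi; rewrite !ord1 !mxE mulVf.
(* x = v + s w is killed by U := Z (1 - s w g) + t (1 - x g), close to Z *)
have eig (w : 'cV_n) : g *m w = 0 ->
    exists e : K, 0 < e /\ forall s : K, `|s| <= e ->
    let x := v + s *: w in A *m x = (g *m A *m x) 0 0 *: x.
  move=> gw.
  pose P : 'M[K]_n := 1%:M - v *m g.
  (* The terms bound the three parts of U - Z = t P - s Z w g - t s w g; e <= 1 reduces the product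
     t s to one factor, and the final 1 makes the estimate strict. *)
  pose S := mx_norm1 P + mx_norm1 (Z *m w *m g) + mx_norm1 (w *m g) + 1.
  have S0 : 0 < S by rewrite ltr_wpDl ?addr_ge0 ?mx_norm1_ge0.
  have [||e [e0 e1 er]] := @exists_lower_bound2 _ 1 (r / S).
  - by [].
  - by rewrite divr_gt0.
  exists e; split=> // s se x.
  have gx : g *m x = 1%:M by rewrite mulmxDr -scalemxAr gw scaler0 addr0.
  pose U t : 'M[K]_n := Z - s *: (Z *m w *m g) + t *: (1%:M - x *m g).
  have Ux t : U t *m x = 0.
    rewrite /U mulmxDl mulmxBl -!scalemxAl mulmxBl mul1mx -!mulmxA gx !mulmx1.
    by rewrite subrr scaler0 addr0 mulmxDr Zv add0r -scalemxAr subrr.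
  have UAx t : `|t| <= e -> U t *m A *m x = 0.
    move=> te; apply: Aker (Ux t) => i j.
    have -> : U t i j - Z i j = t * P i j - s * (Z *m w *m g) i j -
        t * s * (w *m g) i j.
      rewrite /U /P /x mulmxDl -scalemxAl !mxE; ring.
    have : e * S <= r by rewrite -ler_pdivlMr.
    apply: lt_le_trans; rewrite /S !mulrDr mulr1 ltr_pwDr//.
    have bnd (k : K) (B : 'M[K]_n) a b : `|k| <= e ->
        `|k * B a b| <= e * mx_norm1 B.
      by move=> ke; rewrite normrM ler_pM// ler_norm_mx_norm1.
    rewrite (le_trans (ler_normB _ _))// lerD ?bnd//; last first.
      by rewrite normrM -[e]mulr1 ler_pM// (le_trans se).
    by rewrite (le_trans (ler_normB _ _))// lerD ?bnd.
  (* Subtracting the case t = 0 from t = e leaves (1 - x g) A x = 0. *)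
  have := UAx e; rewrite gtr0_norm// lexx => /(_ isT).
  have := UAx 0; rewrite normr0 (ltW e0) => /(_ isT).
  rewrite {1}/U scale0r addr0 => U0 /eqP.
  rewrite /U -[_ *m A *m x]mulmxA mulmxDl !mulmxA U0 add0r -2!scalemxAl.
  rewrite scaler_eq0 gt_eqF//= -mulmxA mulmxBl mul1mx subr_eq0 => /eqP Ax.
  by rewrite [LHS]Ax -!mulmxA mul_cV_mx11 !mulmxA.
pose l := (g *m A *m v) 0 0; exists l.
have Av : A *m v = l *: v.
  have [|e [e0 /(_ 0)]] := eig 0; first by rewrite mulmx0.
  by rewrite normr0 ltW//= scale0r addr0; apply.
have Aw (w : 'cV_n) : g *m w = 0 -> A *m w = l *: w.
  move=> gw; have [e [e0 eigw]] := eig w gw.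
  pose m := (g *m A *m w) 0 0.
  (* The eigenvalue at v + s w is l + s m. Comparing s = e with s = e/2 forces m w = 0, so m = 0 or
     w = 0. *)
  have Aws s : s != 0 -> `|s| <= e -> A *m w = m *: v + l *: w + (s * m) *: w.
    move=> s0 /eigw /=.
    have -> : (g *m A *m (v + s *: w)) 0 0 = l + s * m.
      rewrite /l /m mulmxDr -scalemxAr.
      by move: (_ *m v) (_ *m w) => X Y; rewrite !mxE.
    rewrite mulmxDr -scalemxAr Av => Es.
    apply: (scalerI s0); rewrite -[LHS](addKr (l *: v)) {}Es.
    clearbody l m v; apply/matrixP => i j; rewrite !mxE; ring.
  have Ae : A *m w = m *: v + l *: w + (e * m) *: w.
    by apply: Aws; rewrite ?gt_eqF// gtr0_norm.
  have : A *m w = m *: v + l *: w + (e / 2 * m) *: w.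
    apply: Aws; rewrite ?gt_eqF ?divr_gt0// gtr0_norm ?divr_gt0//.
    by rewrite ler_pdivrMr// ler_peMr ?ler1n// ltW.
  rewrite {1}Ae => /addrI/eqP; rewrite -subr_eq0 -scalerBl -mulrBl scaler_eq0.
  rewrite {1}[e]splitr addrK !mulf_eq0 gt_eqF// invr_eq0 pnatr_eq0/=.
  case/orP => /eqP; [move=> m0|].
    by rewrite Ae m0 mulr0 !scale0r addr0 add0r.
  by move=> ->; rewrite mulmx0 scaler0.
suff AE j : col j A = col j l%:M.
  by apply/matrixP => i j; have /matrixP/(_ i 0) := AE j; rewrite mxE [RHS]mxE.
rewrite !colE mul_scalar_mx; set x := delta_mx j 0.
(* Each basis vector splits along the line of v and the kernel of g, on both of which A acts as
   l. *)
pose c := (g *m x) 0 0; pose w := x - c *: v.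
have gw : g *m w = 0.
  by rewrite mulmxBr -scalemxAr gv scalemx1 -mx11_scalar subrr.
have -> : x = w + c *: v by rewrite subrK.
by rewrite mulmxDr Aw// -scalemxAr Av [RHS]scalerDr !scalerA [c * l]mulrC.
Qed.

Lemma conj_bounded_scalar (K : numFieldType) (n : nat) (Z : 'M[K]_n) (l : K) :
  conj_bounded id l%:M Z.
Proof.
exists 1, `|l|; split => // U Uu _ i j /=.
rewrite scalar_mxC -mulmxA mulmxV// mulmx1 mxE.
by case: (i == j); rewrite ?mulr1n// mulr0n normr0.
Qed.

(** * Operator norm versus entries *)

Lemma normcE (R : rcfType) (x : R[i]) : `|x| = (Normc.normc x)%:C.
Proof. by []. Qed.

Lemma normc_ge0 (R : rcfType) (x : R[i]) : 0 <= Normc.normc x.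
Proof. by rewrite -ler0c -normcE. Qed.

Lemma normc_sum (R : rcfType) (I : finType) (F : I -> R[i]) :
  Normc.normc (\sum_i F i) <= \sum_i Normc.normc (F i).
Proof.
elim/big_ind2: _ => [|x a y b xa yb|//]; first by rewrite Normc.normc0.
by rewrite (le_trans (le_normcD _ _))// lerD.
Qed.

Lemma normc_le_euclidean_norm (R : realType) (n : nat) (v : 'cV[R[i]]_n) i :
  Normc.normc (v i 0) <= euclidean_norm v.
Proof.
rewrite -[leLHS]ger0_norm ?normc_ge0// -sqrtr_sqr ler_wsqrtr//.
apply: (ler_sum_term i (F := fun i => Normc.normc (v i 0) ^+ 2)) => j.
exact: sqr_ge0.
Qed.

(** The square of a sum of nonnegative reals dominates the sum of their squares. *)
Lemma euclidean_norm_le_sum (R : realType) (n : nat) (v : 'cV[R[i]]_n) :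
  euclidean_norm v <= \sum_i Normc.normc (v i 0).
Proof.
have s0 (I : seq 'I_n) : 0 <= \sum_(i <- I) Normc.normc (v i 0).
  by apply: sumr_ge0 => *; exact: normc_ge0.
rewrite -[leRHS]ger0_norm ?s0// -sqrtr_sqr ler_wsqrtr//.
elim: (index_enum _) => [|i s IH]; first by rewrite !big_nil expr0n.
rewrite !big_cons sqrrD -addrA lerD// (le_trans IH)// lerDr mulrn_wge0//.
by rewrite mulr_ge0 ?normc_ge0 ?s0.
Qed.

Lemma euclidean_norm_mulmx_le (R : realType) (n : nat) (A : 'M[R[i]]_n)
    (v : 'cV[R[i]]_n) :
  euclidean_norm v <= 1 ->
  euclidean_norm (A *m v) <= \sum_i \sum_j Normc.normc (A i j).
Proof.
move=> v1; rewrite (le_trans (euclidean_norm_le_sum _))// ler_sum// => i _.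
rewrite mxE (le_trans (normc_sum _))// ler_sum// => j _.
rewrite Normc.normcM ler_piMr ?normc_ge0//.
exact: le_trans (normc_le_euclidean_norm _ _) v1.
Qed.

Lemma op_norm_le_sum (R : realType) (n : nat) (A : 'M[R[i]]_n) :
  op_norm A <= \sum_i \sum_j Normc.normc (A i j).
Proof.
apply: ge_sup => [|_ [v v1 <-]]; last exact: euclidean_norm_mulmx_le.
(* The bound on [sup] needs a nonempty set; the zero vector provides a point. *)
exists (euclidean_norm (A *m 0)), 0 => //=.
rewrite /euclidean_norm big1 ?sqrtr0 ?ler01// => i _.
by rewrite mxE Normc.normc0 expr0n.
Qed.

(** The entry is a coordinate of A e_j, and e_j lies in the unit ball. *)
Lemma normc_le_op_norm (R : realType) (n : nat) (A : 'M[R[i]]_n) i j :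
  Normc.normc (A i j) <= op_norm A.
Proof.
pose e : 'cV[R[i]]_n := delta_mx j 0.
have -> : A i j = (A *m e) i 0 by rewrite -colE mxE.
apply: le_trans (normc_le_euclidean_norm _ _) _.
apply: ub_le_sup.
  exists (\sum_i \sum_j Normc.normc (A i j)) => _ [v v1 <-].
  exact: euclidean_norm_mulmx_le.
exists e => //=; rewrite (le_trans (euclidean_norm_le_sum _))//.
rewrite (bigD1 j)//= big1 => [|k kj]; last first.
  by rewrite mxE (negbTE kj) Normc.normc0.
by rewrite mxE !eqxx Normc.normc1 addr0.
Qed.

(** The suprema grow with r, so a finite limsup means a finite supremum at one r > 0; norm and
    entries control each other up to constants. *)
Lemma S_capP (R : realType) (n : nat)
    (phi : {linear 'M[R[i]]_n -> 'M[R[i]]_n}) (A Z : 'M[R[i]]_n) :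
  S_cap phi Z A <-> conj_bounded phi A Z.
Proof.
rewrite /S_cap /= /N_cap; set f := (X in limf_esup X _).
rewrite limf_esupE; split.
- move=> /ereal_inf_lt[_ [V V0 <-] Voo].
  have [r [Vr r0]] : exists r, V r /\ 0 < r.
    exact: (filter_ex (filterI V0 (nbhs_right_gt 0))).
  have : exists2 M : R, 0 <= M & (ereal_sup [set f s | s in V] <= M%:E)%E.
    case: ereal_sup Voo => [M| |]//= _.
    + by exists `|M| => //; rewrite lee_fin ler_norm.
    + by exists 0 => //; rewrite leNye.
  move=> [M M0 /ereal_supP VM].
  (* N is n^2: entries below r/(N+1) give operator norm at most r N/(N+1) < r, also when n = 0. *)
  pose N := \sum_(i < n) \sum_(j < n) (1 : R).
  have N0 : 0 <= N by do 2!apply: sumr_ge0 => ? _.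
  have N1 : 0 < N + 1 by rewrite ltr_wpDl.
  exists (r / (N + 1))%:C, M%:C; split.
  + by rewrite ltcR divr_gt0.
  + by rewrite ler0c.
  move=> U Uu UZ i j; rewrite normcE lecR (le_trans (normc_le_op_norm _ _ _))//.
  rewrite -lee_fin; have /ereal_supP := VM _ (ex_intro2 _ _ r Vr erefl); apply.
  exists U => //; split=> //; apply: le_lt_trans (op_norm_le_sum _) _.
  apply: (@le_lt_trans _ _ (r / (N + 1) * N)).
    rewrite mulr_sumr ler_sum// => k _; rewrite mulr_sumr ler_sum// => l _.
    by rewrite mulr1 !mxE -lecR -normcE ltW.
  by rewrite mulrAC -mulrA gtr_pMr// ltr_pdivrMr// mul1r ltrDl.
- move=> [[r r'] [[M M'] []]]; rewrite ltcE lecE /=.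
  (* Comparison with 0 in [R[i]] makes the radius and the bound real. *)
  move=> /andP[/eqP-> r0] /andP[/eqP-> M0] AM.
  pose N := \sum_(i < n) \sum_(j < n) M.
  apply: (@le_lt_trans _ _ N%:E); last exact: ltry.
  apply: ereal_inf_le; eexists.
    by exists [set s | s <= r] => //; exact: nbhs_right_le.
  apply: ge_ereal_sup => _ [s /= sr <-].
  apply: ge_ereal_sup => _ [U [Uu UZ] <-].
  rewrite lee_fin (le_trans (op_norm_le_sum _))// ler_sum// => i _.
  rewrite ler_sum// => j _; rewrite -lecR -normcE; apply: AM => // k l.
  rewrite normcE ltcR (le_lt_trans _ (lt_le_trans UZ sr))//.
  by have := normc_le_op_norm (U - Z) k l; rewrite !mxE.
Qed.

Theorem theorem1p15 (R : realType) (n : nat) (J Z : 'M[R[i]]_n)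
    (hJ : forall i j : 'I_n, i != j -> J i j != 0) :
  S_cap (hadamard J) Z = S_cap idfun Z /\
  (Z \notin unitmx ->
   S_cap (hadamard J) Z = [set A | exists lambda : R[i], A = lambda%:M]).
Proof.
have SE : S_cap (hadamard J) Z = S_cap idfun Z.
  apply/seteqP; split=> A /S_capP AZ; apply/S_capP.
    exact: conj_bounded_of_hadamard hJ AZ.
  exact: (@conj_bounded_hadamard _ _ J A Z AZ).
split; [exact: SE|move=> Zs; apply: (etrans SE)]; apply/seteqP; split=> A.
  by move=> /S_capP; exact: conj_bounded_singular_scalar.
by move=> [l ->]; apply/S_capP; exact: conj_bounded_scalar.
Qed.
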